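(* Let $n\ge1$ and let $\mathbf{L}$ be a De~Morgan lattice. The $n$-prime filters on $\mathbf{L}$ are precisely the sets $h^{-1}[G]$ for De~Morgan lattice homomorphisms $h\colon\mathbf{L}\to(\mathbf{DM}_1)^n$, where $G$ is the designated set of the direct power $(\boldsymbol{\mathcal{DM}}_1)^n$. Likewise the complete (respectively consistent, classical) $n$-prime filters on $\mathbf{L}$ are precisely the homomorphic preimages of the designated set of $(\boldsymbol{\mathcal{P}}_1)^n$ (respectively $(\boldsymbol{\mathcal{K}}_1)^n$, $(\boldsymbol{\mathcal{B}}_1)^n$).
   Context: A De~Morgan lattice is a distributive lattice with unary $\neg$ satisfying $\neg\neg x=x$ and the De~Morgan laws. $\mathbf{DM}_1$ is the four-element De~Morgan lattice on $\{\mathsf f,\mathsf n,\mathsf b,\mathsf t\}$ with $\mathsf f<\mathsf n,\mathsf b<\mathsf t$, $\mathsf n,\mathsf b$ incomparable, $\neg\mathsf t=\mathsf f$, $\neg\mathsf n=\mathsf n$, $\neg\mathsf b=\mathsf b$. $\boldsymbol{\mathcal{DM}}_1=\langle\mathbf{DM}_1,\{\mathsf t,\mathsf b\}\rangle$; $\boldsymbol{\mathcal{P}}_1$, $\boldsymbol{\mathcal{K}}_1$, $\boldsymbol{\mathcal{B}}_1$ are its substructures with universes $\{\mathsf t,\mathsf b,\mathsf f\}$, $\{\mathsf t,\mathsf n,\mathsf f\}$, $\{\mathsf t,\mathsf f\}$ and designated sets $\{\mathsf t,\mathsf b\}$, $\{\mathsf t\}$, $\{\mathsf t\}$. The direct power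 of a structure $\langle\mathbf{A},F\rangle$ is $\langle\mathbf{A}^n,\bigcap_k\pi_k^{-1}[F]\rangle$ (tuples all of whose coordinates are designated). An $n$-ideal is an $n$-filter of the order dual lattice, where an $n$-filter is an upset $F$ such that for every non-empty finite $Y$: if $\bigwedge X\in F$ for all non-empty $X\subseteq Y$ with $|X|\le n$, then $\bigwedge Y\in F$. A filter $F$ is $n$-prime if its complement is an $n$-ideal. A filter is complete if it is non-empty and $x\in F$ implies $x\wedge(y\vee\neg y)\in F$; consistent if $F\ne L$ and $(x\wedge\neg x)\vee y\in F$ implies $y\in F$; classical if both complete and consistent. *)

(* Defs.v *)
From HB Require Import structures.
From mathcomp Require Import all_boot all_order finmap.
From mathcomp Require Import boolp classical_sets.

Set Implicit Arguments.
Unset Strict Implicit.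
Unset Printing Implicit Defensive.

Import Order.TTheory.
Local Open Scope classical_set_scope.

HB.mixin Record DistrLattice_isDeMorganLattice d T of Order.DistrLattice d T := {
  dmneg : T -> T;
  dmnegK : involutive dmneg;
  dmnegI : forall x y : T, dmneg (x `&` y)%O = (dmneg x `|` dmneg y)%O;
  dmnegU : forall x y : T, dmneg (x `|` y)%O = (dmneg x `&` dmneg y)%O
}.

#[short(type="deMorganLatticeType")]
HB.structure Definition DeMorganLattice (d : Order.disp_t) :=
  { T of Order.DistrLattice d T & DistrLattice_isDeMorganLattice d T }.

Definition dm_morphism d (L : deMorganLatticeType d) d'
    (M : deMorganLatticeType d') (h : L -> M) : Prop :=
  [/\ forall x y, h (x `&` y)%O = (h x `&` h y)%O,
      forall x y, h (x `|` y)%O = (h x `|` h y)%O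
    & forall x, h (dmneg x) = dmneg (h x)].

HB.mixin Record isDMNegClosed d (L : deMorganLatticeType d) (S : {pred L}) := {
  dmneg_closed : forall x, x \in S -> dmneg x \in S
}.

#[short(type="dmClosed")]
HB.structure Definition DMClosed d (L : deMorganLatticeType d) :=
  { S of Order.isMeetLatticeClosed d L S & Order.isJoinLatticeClosed d L S
       & isDMNegClosed d L S }.

Section Subalgebra.
Variables (d : Order.disp_t) (L : deMorganLatticeType d) (S : dmClosed L).

Definition dm_sub := {x : L | x \in S}.

HB.instance Definition _ := SubChoice.on dm_sub.
HB.instance Definition _ := [SubChoice_isSubLattice of dm_sub by <: with d].

Fact dm_sub_meetUl : @left_distributive dm_sub dm_sub Order.meet Order.join.
Proof. by move=> x y z; apply: val_inj; exact: meetUl. Qed.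

HB.instance Definition _ :=
  Order.Lattice_Meet_isDistrLattice.Build d dm_sub dm_sub_meetUl.

Definition dm_sub_neg (x : dm_sub) : dm_sub :=
  exist _ (dmneg (val x)) (dmneg_closed _ (valP x)).

Fact dm_sub_negK : involutive dm_sub_neg.
Proof. by move=> x; apply: val_inj; rewrite /= dmnegK. Qed.

Fact dm_sub_negI (x y : dm_sub) :
  dm_sub_neg (x `&` y)%O = (dm_sub_neg x `|` dm_sub_neg y)%O.
Proof. by apply: val_inj; rewrite /= dmnegI. Qed.

Fact dm_sub_negU (x y : dm_sub) :
  dm_sub_neg (x `|` y)%O = (dm_sub_neg x `&` dm_sub_neg y)%O.
Proof. by apply: val_inj; rewrite /= dmnegU. Qed.

HB.instance Definition _ := DistrLattice_isDeMorganLattice.Build d dm_sub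
  dm_sub_negK dm_sub_negI dm_sub_negU.

End Subalgebra.

Section Power.
Variables (d : Order.disp_t) (L : deMorganLatticeType d) (n : nat).

Definition dm_power := n.-tupleprod[d] L.

HB.instance Definition _ := Order.DistrLattice.on dm_power.

Definition dm_power_neg (t : dm_power) : dm_power :=
  [tuple dmneg (tnth t i) | i < n].

Fact dm_power_negK : involutive dm_power_neg.
Proof. by move=> t; apply: eq_from_tnth => i; rewrite !tnth_mktuple dmnegK. Qed.

Fact dm_power_negI (s t : dm_power) :
  dm_power_neg (s `&` t)%O = (dm_power_neg s `|` dm_power_neg t)%O.
Proof. by apply: eq_from_tnth => i; rewrite !tnth_mktuple dmnegI. Qed.

Fact dm_power_negU (s t : dm_power) :
  dm_power_neg (s `|` t)%O = (dm_power_neg s `&` dm_power_neg t)%O.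
Proof. by apply: eq_from_tnth => i; rewrite !tnth_mktuple dmnegU. Qed.

HB.instance Definition _ := DistrLattice_isDeMorganLattice.Build d dm_power
  dm_power_negK dm_power_negI dm_power_negU.

End Power.

Record dmStructure := DMStructure {
  dms_disp : Order.disp_t;
  dms_alg :> deMorganLatticeType dms_disp;
  designated : set dms_alg
}.

Arguments designated : clear implicits.

Definition substructure (A : dmStructure) (S : dmClosed A) : dmStructure :=
  @DMStructure _ (dm_sub S) (val @^-1` designated A).

Definition power_structure (A : dmStructure) (n : nat) : dmStructure :=
  @DMStructure _ (dm_power A n)
    (\bigcap_(k in [set: 'I_n]) ((fun t => tnth t k) @^-1` designated A)).

Variant dm1 := DMf | DMn | DMb | DMt.

Definition dm1_code (x : dm1) : bool * bool :=
  match x with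
  | DMf => (false, false) | DMn => (false, true)
  | DMb => (true, false) | DMt => (true, true)
  end.
Definition dm1_decode (c : bool * bool) : dm1 :=
  match c with
  | (false, false) => DMf | (false, true) => DMn
  | (true, false) => DMb | (true, true) => DMt
  end.
Fact dm1_codeK : cancel dm1_code dm1_decode. Proof. by case. Qed.

HB.instance Definition _ := Countable.copy dm1 (can_type dm1_codeK).

Definition dm1_le (x y : dm1) : bool :=
  match x, y with
  | DMf, _ | _, DMt | DMn, DMn | DMb, DMb => true
  | _, _ => false
  end.
Definition dm1_meet (x y : dm1) : dm1 :=
  match x, y with
  | DMt, z | z, DMt => z
  | DMn, DMn => DMn
  | DMb, DMb => DMb
  | _, _ => DMf
  end.
Definition dm1_join (x y : dm1) : dm1 :=
  match x, y with
  | DMf, z | z, DMf => z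
  | DMn, DMn => DMn
  | DMb, DMb => DMb
  | _, _ => DMt
  end.
Definition dm1_neg (x : dm1) : dm1 :=
  match x with DMf => DMt | DMn => DMn | DMb => DMb | DMt => DMf end.

Fact dm1_leE x y : dm1_le x y = (dm1_meet x y == x).
Proof. by case: x; case: y. Qed.
Fact dm1_meetC : commutative dm1_meet. Proof. by do 2!case. Qed.
Fact dm1_joinC : commutative dm1_join. Proof. by do 2!case. Qed.
Fact dm1_meetA : associative dm1_meet. Proof. by do 3!case. Qed.
Fact dm1_joinA : associative dm1_join. Proof. by do 3!case. Qed.
Fact dm1_joinKI y x : dm1_meet x (dm1_join x y) = x.
Proof. by case: x; case: y. Qed.
Fact dm1_meetKU y x : dm1_join x (dm1_meet x y) = x.
Proof. by case: x; case: y. Qed.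
Fact dm1_meetUl : left_distributive dm1_meet dm1_join. Proof. by do 3!case. Qed.
Fact dm1_meetxx : idempotent_op dm1_meet. Proof. by case. Qed.

Fact dm1_display : Order.disp_t. Proof. exact: (Order.Disp tt tt). Qed.

HB.instance Definition _ :=
  @Order.isMeetJoinDistrLattice.Build dm1_display dm1
    dm1_le (fun x y => (y != x) && dm1_le x y) dm1_meet dm1_join
    dm1_leE (fun _ _ => erefl) dm1_meetC dm1_joinC dm1_meetA dm1_joinA
    dm1_joinKI dm1_meetKU dm1_meetUl dm1_meetxx.

Fact dm1_negK : involutive dm1_neg. Proof. by case. Qed.
Fact dm1_negI (x y : dm1) : dm1_neg (x `&` y)%O = (dm1_neg x `|` dm1_neg y)%O.
Proof. by case: x; case: y. Qed.
Fact dm1_negU (x y : dm1) : dm1_neg (x `|` y)%O = (dm1_neg x `&` dm1_neg y)%O.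
Proof. by case: x; case: y. Qed.

HB.instance Definition _ := DistrLattice_isDeMorganLattice.Build
  dm1_display dm1 dm1_negK dm1_negI dm1_negU.

Definition P1_universe : {pred dm1} := [pred x | x \in [:: DMt; DMb; DMf]].
Definition K1_universe : {pred dm1} := [pred x | x \in [:: DMt; DMn; DMf]].
Definition B1_universe : {pred dm1} := [pred x | x \in [:: DMt; DMf]].

Fact P1_meet : meet_closed P1_universe. Proof. by do 2!case. Qed.
Fact P1_join : join_closed P1_universe. Proof. by do 2!case. Qed.
Fact P1_neg (x : dm1) : x \in P1_universe -> dmneg x \in P1_universe.
Proof. by case: x. Qed.
HB.instance Definition _ :=
  Order.isMeetLatticeClosed.Build _ dm1 P1_universe P1_meet.
HB.instance Definition _ :=
  Order.isJoinLatticeClosed.Build _ dm1 P1_universe P1_join.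
HB.instance Definition _ := isDMNegClosed.Build _ dm1 P1_universe P1_neg.

Fact K1_meet : meet_closed K1_universe. Proof. by do 2!case. Qed.
Fact K1_join : join_closed K1_universe. Proof. by do 2!case. Qed.
Fact K1_neg (x : dm1) : x \in K1_universe -> dmneg x \in K1_universe.
Proof. by case: x. Qed.
HB.instance Definition _ :=
  Order.isMeetLatticeClosed.Build _ dm1 K1_universe K1_meet.
HB.instance Definition _ :=
  Order.isJoinLatticeClosed.Build _ dm1 K1_universe K1_join.
HB.instance Definition _ := isDMNegClosed.Build _ dm1 K1_universe K1_neg.

Fact B1_meet : meet_closed B1_universe. Proof. by do 2!case. Qed.
Fact B1_join : join_closed B1_universe. Proof. by do 2!case. Qed.
Fact B1_neg (x : dm1) : x \in B1_universe -> dmneg x \in B1_universe.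
Proof. by case: x. Qed.
HB.instance Definition _ :=
  Order.isMeetLatticeClosed.Build _ dm1 B1_universe B1_meet.
HB.instance Definition _ :=
  Order.isJoinLatticeClosed.Build _ dm1 B1_universe B1_join.
HB.instance Definition _ := isDMNegClosed.Build _ dm1 B1_universe B1_neg.

Definition DM1 : dmStructure := @DMStructure _ dm1 [set DMt; DMb].
Definition P1 : dmStructure := @substructure DM1 P1_universe.
Definition K1 : dmStructure := @substructure DM1 K1_universe.
Definition B1 : dmStructure := @substructure DM1 B1_universe.

Section Filters.
Variables (d : Order.disp_t) (L : latticeType d).

Definition upset (F : set L) : Prop := forall x y, F x -> (x <= y)%O -> F y.

(* The empty set is allowed as a filter. *)
Definition lattice_filter (F : set L) : Prop :=
  upset F /\ forall x y, F x -> F y -> F (x `&` y)%O.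

(* Equals the meet of X whenever x \in X; it does not depend on the choice of
   such an x, and no top element is needed. *)
Definition fset_meet (x : L) (X : {fset L}) : L :=
  (\big[Order.meet/x]_(y <- X) y)%O.

(* The witnesses y \in Y and x \in X also say that Y and X are non-empty. *)
Definition n_filter (n : nat) (F : set L) : Prop :=
  upset F /\
  forall (Y : {fset L}) (y : L), y \in Y ->
    (forall (X : {fset L}) (x : L), x \in X -> (X `<=` Y)%fset ->
       (#|` X| <= n)%N -> F (fset_meet x X)) ->
    F (fset_meet y Y).

End Filters.

Definition n_ideal d (L : latticeType d) (n : nat) (I : set L) : Prop :=
  @n_filter _ L^d n I.

Definition n_prime_filter d (L : latticeType d) (n : nat) (F : set L) : Prop :=
  lattice_filter F /\ n_ideal n (~` F).

Section DeMorganFilters.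
Variables (d : Order.disp_t) (L : deMorganLatticeType d).

Definition complete_filter (F : set L) : Prop :=
  F !=set0 /\ forall x y, F x -> F (x `&` (y `|` dmneg y))%O.

Definition consistent_filter (F : set L) : Prop :=
  F <> [set: L] /\ forall x y, F ((x `&` dmneg x) `|` y)%O -> F y.

Definition classical_filter (F : set L) : Prop :=
  complete_filter F /\ consistent_filter F.

Definition hom_preimage (A : dmStructure) (F : set L) : Prop :=
  exists2 h : L -> A, dm_morphism h & F = h @^-1` designated A.

End DeMorganFilters.

(* Main.v *)
(** A prime filter [P], possibly empty or total, is the preimage of [{t, b}]
    under the homomorphism into DM1 recording whether [x] is in [P] and whether
    [dmneg x] is outside [P], so everything rests on writing an [n]-prime filter
    [F] as an intersection of [n] prime filters.  Call a finite set comaximal if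
    its elements lie outside [F] but any two of them join into [F].  If [K] is
    comaximal with more than [n] elements, the meets of all but one element of
    [K] join into [F], while any [n] of these meets lie below a single element
    of [K]; hence [n]-primality bounds the size of [K] by [n].  When [K] has
    maximal size, the filters [{x | x \/ u in F}], for [u] in [K], are prime and
    intersect to [F]: a failure of either would give a larger comaximal set.
    Consistency of [F] passes to these filters since [u] is outside [F]. *)

Require Import Defs.
From mathcomp Require Import all_boot all_order finmap.
From mathcomp Require Import boolp classical_sets.

Set Implicit Arguments.
Unset Strict Implicit.
Unset Printing Implicit Defensive.

Import Order.TTheory.
Local Open Scope classical_set_scope.
Local Open Scope order_scope.

Lemma fsub_imfsetD1 (T T' : choiceType) (f : T -> T') (A : {fset T})
    (X : {fset T'}) :
  (X `<=` f @` A)%fset -> (#|` X| < #|` A|)%N ->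
  exists2 a, a \in A & (X `<=` f @` (A `\ a))%fset.
Proof.
move=> /fsubsetP XfA ltXA.
have /choice[g gP] (x : T') : exists a, x \in X -> a \in A /\ f a = x.
  have [/XfA/imfsetP[a Aa ->]|_] := boolP (x \in X); first by exists a.
  have /fset0Pn[a _] : A != fset0 by rewrite -cardfs_gt0 (leq_ltn_trans _ ltXA).
  by exists a.
have [a Aa nga] : exists2 a, a \in A & a \notin (g @` X)%fset.
  apply/fsubsetPn; apply: contraL ltXA => /fsubset_leq_card leA.
  by rewrite -leqNgt (leq_trans leA) ?leq_imfset_card.
exists a => //; apply/fsubsetP => x Xx; have [Ag <-] := gP x Xx.
apply: in_imfset; rewrite !inE Ag andbT.
by apply: contraNneq nga => <-; exact: in_imfset.
Qed.

Section FsetMeet.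
Variables (d : Order.disp_t) (L : latticeType d).
Implicit Type K : {fset L}.

Lemma fset_meetP (u x : L) K :
  reflect (u <= x /\ {in K, forall y, u <= y}) (u <= fset_meet x K).
Proof.
rewrite /fset_meet.
have -> : (u <= \big[Order.meet/x]_(y <- K) y) = (u <= x) && all (>= u) K.
  elim: (enum_fset K) => [|y s IHs]; first by rewrite big_nil andbT.
  by rewrite big_cons lexI IHs /= andbCA.
by apply: (iffP andP) => -[ux /allP uK].
Qed.

Lemma fset_meet_le (x y : L) K : y \in K -> fset_meet x K <= y.
Proof. by have /fset_meetP[_] := lexx (fset_meet x K); apply. Qed.

End FsetMeet.

Section PrimeFilters.
Variables (d : Order.disp_t) (L : latticeType d).
Implicit Types (F P : set L) (K Y : {fset L}) (n : nat).

Lemma lattice_filter_fset_meet F (x : L) K :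
  lattice_filter F -> F x -> {in K, forall y, F y} -> F (fset_meet x K).
Proof.
move=> [_ FI] Fx FK; rewrite /fset_meet big_seq.
by apply: big_ind => // y Ky; exact: FK.
Qed.

Lemma lattice_filterI F (x y : L) :
  lattice_filter F -> F (x `&` y) <-> F x /\ F y.
Proof.
case=> upF FI; split=> [Fxy|[]]; last exact: FI.
by split; apply: upF Fxy _; rewrite ?leIl ?leIr.
Qed.

Lemma lattice_filter_bigcap (T : Type) (P : T -> set L) :
  (forall i, lattice_filter (P i)) -> lattice_filter (\bigcap_i P i).
Proof.
move=> filtP; split=> [x y Px xy i _|x y Px Py i _].
  exact: (filtP i).1 (Px i I) xy.
exact: (filtP i).2 (Px i I) (Py i I).
Qed.

Definition prime_filter P : Prop :=
  lattice_filter P /\ forall x y, P (x `|` y) -> P x \/ P y.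

Lemma prime_filterT : prime_filter [set: L].
Proof. by split=> //; left. Qed.

Lemma prime_filterU P (x y : L) :
  prime_filter P -> P (x `|` y) <-> P x \/ P y.
Proof.
case=> [[upP _] PU]; split; first exact: PU.
by case=> Pz; apply: upP Pz _; rewrite ?leUl ?leUr.
Qed.

Lemma prime_filter_fset_join P (x : L) Y :
  prime_filter P -> x \in Y -> P (fset_meet (x : L^d) (Y : {fset L^d})) ->
  exists2 y, y \in Y & P y.
Proof.
move=> primeP Yx; rewrite /fset_meet big_seq => PY; apply: contrapT => nP.
have nPY y : y \in Y -> ~ P y by move=> Yy Py; apply: nP; exists y.
move: PY; apply: (@big_ind L^d (fun y => ~ P y)); [exact: nPY| |exact: nPY].
by move=> y z nPy nPz /prime_filterU[].
Qed.

Lemma bigcap_n_prime_filter n (T : finType) (P : T -> set L) :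
  (0 < n)%N -> (#|T| <= n)%N -> (forall i, prime_filter (P i)) ->
  n_prime_filter n (\bigcap_i P i).
Proof.
move=> n_gt0 leTn primeP.
have filtP : lattice_filter (\bigcap_i P i).
  by apply: lattice_filter_bigcap => i; case: (primeP i).
split=> //; split=> [x y nPx yx Py|Y y Yy nPX PY].
  by apply: nPx; exact: filtP.1 Py yx.
have /choice[f fP] i : exists y, y \in Y /\ P i y.
  by have [z] := prime_filter_fset_join (primeP i) Yy (PY i I); exists z.
pose X : {fset L^d} := [fset f i | i : T]%fset.
have [i0 _|T0] := pickP T; last first.
  apply: (nPX [fset y]%fset y); rewrite ?fset11 ?fsub1set ?cardfs1 // => i.
  by have := T0 i.
have Xf i : f i \in X by apply/imfsetP; exists i.
apply: (nPX X (f i0) (Xf _)) => [||i _].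
- by apply/fsubsetP=> _ /imfsetP[i _ ->]; exact: (fP i).1.
- by rewrite (leq_trans (leq_imfset_card _ _ _)) //= -cardE.
- apply: (primeP i).1.1 (fP i).2 _.
  exact: (@fset_meet_le _ L^d _ _ _ (Xf i)).
Qed.

End PrimeFilters.

Lemma prime_filter_preimage d (L : latticeType d) d' (M : latticeType d')
    (h : M -> L) (P : set L) :
  {morph h : x y / x `&` y} -> {morph h : x y / x `|` y} ->
  prime_filter P -> prime_filter (h @^-1` P).
Proof.
move=> hI hU [filtP PU]; split=> [|x y] /=; last by rewrite hU; exact: PU.
split=> [x y /= Px /meet_idPl xy|x y Px Py] /=.
  by move: Px; rewrite -xy hI => /(lattice_filterI _ _ filtP)[].
by rewrite hI; exact: filtP.2.
Qed.

Section ComaximalSets.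
Variables (d : Order.disp_t) (L : distrLatticeType d) (F : set L).
Hypothesis filtF : lattice_filter F.
Implicit Types (K : {fset L}) (n : nat).

Definition residual (u : L) : set L := [set x | F (x `|` u)].

Lemma residual_filter (u : L) : lattice_filter (residual u).
Proof.
split=> [x y /= Fx xy|x y /= Fx Fy]; first by apply: filtF.1 Fx _; exact: leU2.
by rewrite /residual /= joinIl; exact: filtF.2.
Qed.

Lemma sub_residual (u : L) : F `<=` residual u.
Proof. by move=> x Fx; apply: filtF.1 Fx _; exact: leUl. Qed.

Definition comaximal K : Prop :=
  {in K, forall u, ~ F u} /\ {in K &, forall u v, u != v -> F (u `|` v)}.

Lemma comaximal0 : comaximal fset0. Proof. by split=> u. Qed.

Lemma comaximalD1 (u : L) K : comaximal K -> comaximal (K `\ u)%fset.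
Proof.
case=> nFK FK; split=> [v /fsetD1P[_]|v w /fsetD1P[_ Kv] /fsetD1P[_ Kw]].
  exact: nFK.
exact: FK.
Qed.

Lemma comaximalU1 (u : L) K :
  comaximal K -> ~ F u -> {in K, forall v, F (u `|` v)} ->
  u \notin K /\ comaximal (u |` K)%fset.
Proof.
move=> [nFK FK] nFu FuK; split.
  by apply/negP => /FuK; rewrite joinxx.
split=> [v /fset1UP[->//|]|v w]; first exact: nFK.
case/fset1UP=> [->|Kv] /fset1UP[->|Kw]; rewrite ?eqxx // => vw.
- exact: FuK.
- by rewrite joinC; exact: FuK.
- exact: FK.
Qed.

(* The meets of all but one element of [K] join to an element of [F]: each
   [u] in [K] satisfies [F (u `|` v)], hence so does the meet of [K], which
   lies below [v]. *)
Lemma comaximal_upper_bound (t v : L) K :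
  K != fset0 -> F t -> comaximal K ->
  {in K, forall u, fset_meet t (K `\ u)%fset <= v} -> F v.
Proof.
move=> /fset0Pn[a Ka] Ft [_ FK] Kv.
have resK : {in K, forall u, residual v u}.
  move=> u Ku; rewrite /residual /= joinC.
  apply: (residual_filter u).1 (Kv u Ku).
  apply: lattice_filter_fset_meet (residual_filter u) (sub_residual u Ft) _.
  by move=> w /fsetD1P[wu Kw]; exact: FK.
have := lattice_filter_fset_meet (residual_filter v) (sub_residual v Ft) resK.
rewrite /residual /= join_r //.
apply: le_trans (Kv a Ka); apply/fset_meetP; split=> [|w /fsetD1P[_ Kw]].
  by have /fset_meetP[] := lexx (fset_meet t K).
exact: fset_meet_le.
Qed.

Lemma comaximal_leq_card n K :
  (0 < n)%N -> n_ideal n (~` F) -> comaximal K -> (#|` K| <= n)%N.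
Proof.
move=> n_gt0 [_ idF] comK; rewrite leqNgt; apply/negP => ltnK.
have [a Ka] : exists a, a \in K.
  by apply/fset0Pn; rewrite -cardfs_gt0 (leq_trans _ ltnK).
have [b Kb ba] : exists2 b, b \in K & b != a.
  have /fset0Pn[b /fsetD1P[]] : (K `\ a)%fset != fset0; last by exists b.
  by have := leq_ltn_trans n_gt0 ltnK; rewrite (cardfsD1 a K) Ka -cardfs_gt0.
have Fba : F (b `|` a) by exact: comK.2.
pose y u := fset_meet (b `|` a) (K `\ u)%fset.
pose Y : {fset L^d} := (y @` K)%fset.
have Yy u : u \in K -> y u \in Y by exact: in_imfset.
apply: (idF Y (y a) (Yy a Ka)) => [X x Xx XY leXn FX|]; last first.
  apply: (@comaximal_upper_bound (b `|` a) _ K) => //.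
    by apply/fset0Pn; exists a.
  by move=> u Ku; exact: (@fset_meet_le _ L^d _ _ _ (Yy u Ku)).
have [u Ku /fsubsetP Xu] := fsub_imfsetD1 XY (leq_ltn_trans leXn ltnK).
apply: (comK.1 u Ku); apply: filtF.1 FX _.
have leXu : {in X, forall z, z <= u :> L}.
  move=> _ /Xu/imfsetP[v /fsetD1P[vu _] ->].
  by apply: fset_meet_le; rewrite !inE eq_sym vu.
by apply/(@fset_meetP _ L^d); split; [exact: leXu | exact: leXu].
Qed.

Section MaximalComaximalSet.
Variable K : {fset L}.
Hypotheses (comK : comaximal K)
  (maxK : forall K', comaximal K' -> (#|` K'| <= #|` K|)%N).

(* Otherwise [u] could be replaced by the two elements [x `|` u], [y `|` u]. *)
Lemma residual_prime (u : L) : u \in K -> prime_filter (residual u).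
Proof.
move=> Ku; split; first exact: residual_filter.
move=> x y; rewrite /residual /= => Fxyu; apply: contrapT => /not_orP[nFx nFy].
have FKu z : {in (K `\ u)%fset, forall v, F ((z `|` u) `|` v)}.
  move=> v /fsetD1P[vu Kv]; apply: filtF.1 (comK.2 v u Kv Ku vu) _.
  by rewrite joinC leU2 ?leUr.
have [yK comyK] := comaximalU1 (comaximalD1 u comK) nFy (FKu y).
have [|xK /maxK] := comaximalU1 comyK nFx.
  by move=> v /fset1UP[->|/FKu//]; rewrite joinACA joinxx.
by rewrite cardfsU1 xK cardfsU1 yK (cardfsD1 u K) Ku ltnn.
Qed.

Lemma bigcap_residual (x : L) : {in K, forall u, residual u x} -> F x.
Proof.
move=> resx; apply: contrapT => nFx.
have [xK /maxK] := comaximalU1 comK nFx resx.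
by rewrite cardfsU1 xK ltnn.
Qed.

End MaximalComaximalSet.

Lemma maximal_comaximal n :
  (forall K, comaximal K -> (#|` K| <= n)%N) ->
  exists2 K, comaximal K & forall K', comaximal K' -> (#|` K'| <= #|` K|)%N.
Proof.
move=> bound; pose size_of k := exists2 K, comaximal K & #|` K| = k.
have size_ex : exists k, `[< size_of k >].
  exists 0; apply/asboolP; exists fset0; last exact: cardfs0.
  exact: comaximal0.
have size_le k : `[< size_of k >] -> (k <= n)%N.
  by move=> /asboolP[K /bound + <-].
have [_ /asboolP[K comK <-] maxK] := ex_maxnP size_ex size_le.
by exists K => // K' comK'; apply/maxK/asboolP; exists K'.
Qed.

Lemma n_prime_filter_residuals n :
  (0 < n)%N -> inhabited L -> n_ideal n (~` F) ->
  exists u : 'I_n -> L,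
    [/\ forall i, prime_filter (residual (u i)),
        F = \bigcap_i residual (u i)
      & F <> [set: L] -> forall i, ~ F (u i)].
Proof.
move=> n_gt0 [z] idF; have bound K := @comaximal_leq_card n K n_gt0 idF.
have [K comK maxK] := maximal_comaximal bound.
have [K0|[a Ka]] := fset_0Vmem K.
  have FT x : F x by apply: (bigcap_residual comK maxK) => u; rewrite K0.
  have resT u : residual u = [set: L].
    by apply/seteqP; split=> // x _; exact: FT.
  exists (fun=> z); rewrite resT; split=> [i||[]].
  - exact: prime_filterT.
  - by rewrite bigcapT //; apply/seteqP; split.
  - by apply/seteqP; split.
pose u (i : 'I_n) := nth a K i.
have Ku i : u i \in K.
  by rewrite /u; have [/(mem_nth a)|/(nth_default a)->] := ltnP i #|` K|.
exists u; split=> [i||_ i]; last exact: comK.1 (Ku i).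
  exact: residual_prime comK maxK _ (Ku i).
apply/seteqP; split=> x => [Fx i _|resx]; first exact: sub_residual.
apply: (bigcap_residual comK maxK) => v Kv.
have vn : (index v K < n)%N by rewrite (leq_trans _ (bound K comK)) ?index_mem.
by have := resx (Ordinal vn) I; rewrite /u /= nth_index.
Qed.

End ComaximalSets.

Section Homomorphisms.
Variables (d : Order.disp_t) (L : deMorganLatticeType d).
Implicit Types (A : dmStructure) (F P : set L) (n : nat).

Definition representation A n (h : 'I_n -> L -> A) F : Prop :=
  (forall i, dm_morphism (h i)) /\ F = \bigcap_i (h i @^-1` designated A).

Lemma hom_preimage_powerP A n F :
  hom_preimage (power_structure A n) F <->
  exists h : 'I_n -> L -> A, representation h F.
Proof.
split=> [[h [hI hU hN] ->]|[h [homh ->]]].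
  exists (fun i x => tnth (h x) i); split; last exact: preimage_bigcap.
  by move=> i; split=> *; rewrite (hI, hU, hN) !tnth_mktuple.
exists (fun x => [tuple h i x | i < n]).
  split=> [x y|x y|x]; apply: eq_from_tnth => i; rewrite !tnth_mktuple;
    by case: (homh i).
rewrite preimage_bigcap; apply: eq_bigcapr => i _.
by apply/seteqP; split=> x /=; rewrite tnth_mktuple.
Qed.

Lemma dm_morphism_val d' (M : deMorganLatticeType d') (S : dmClosed M)
    (h : L -> dm_sub S) :
  dm_morphism h <-> dm_morphism (val \o h).
Proof.
split=> -[hI hU hN]; first by split=> [x y|x y|x]; rewrite /= (hI, hU, hN).
by split=> [x y|x y|x]; apply: val_inj; [exact: hI | exact: hU | exact: hN].
Qed.

Lemma hom_preimage_power_substructureP A (S : dmClosed A) n F :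
  hom_preimage (power_structure (substructure S) n) F <->
  exists2 h : 'I_n -> L -> A, representation h F & forall i x, h i x \in S.
Proof.
rewrite hom_preimage_powerP; split=> [[h [homh FE]]|[h [homh FE] hS]].
  exists (fun i => val \o h i) => [|i x]; last exact: valP.
  by split=> // i; exact/dm_morphism_val.
exists (fun i x => exist _ (h i x) (hS i x) : dm_sub S); split=> // i.
by apply/dm_morphism_val; exact: homh.
Qed.

Lemma designated_DM1E (v : dm1) : designated DM1 v <-> (dm1_code v).1.
Proof. by case: v; split=> //; by [left | right | case]. Qed.

Lemma designated_DM1_prime : prime_filter (designated DM1).
Proof.
split; first by split=> v w; rewrite !designated_DM1E; case: v; case: w.
move=> v w; rewrite !designated_DM1E => Dvw; apply/orP.
by case: v w Dvw => [] [].
Qed.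

Lemma DM1_excluded_middleP (v : dm1) :
  designated DM1 (v `|` dmneg v) <-> v != DMn.
Proof. by rewrite designated_DM1E; case: v. Qed.

Lemma DM1_contradictionP (v : dm1) :
  designated DM1 (v `&` dmneg v) <-> v = DMb.
Proof. by rewrite designated_DM1E; case: v. Qed.

Definition prime_hom P (x : L) : dm1 :=
  dm1_decode (`[< P x >], ~~ `[< P (dmneg x) >]).

Lemma prime_hom_morphism P : prime_filter P -> dm_morphism (prime_hom P).
Proof.
move=> primeP.
have PI x y : `[< P (x `&` y) >] = `[< P x >] && `[< P y >].
  by rewrite (asbool_equiv_eq (lattice_filterI x y primeP.1)) asbool_and.
have PU x y : `[< P (x `|` y) >] = `[< P x >] || `[< P y >].
  by rewrite (asbool_equiv_eq (prime_filterU x y primeP)) asbool_or.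
split=> [x y|x y|x]; rewrite /prime_hom.
- by rewrite dmnegI PI PU; do 4!case: `[< _ >].
- by rewrite dmnegU PI PU; do 4!case: `[< _ >].
- by rewrite dmnegK; do 2!case: `[< _ >].
Qed.

Lemma prime_hom_preimage P : prime_hom P @^-1` designated DM1 = P.
Proof.
apply/seteqP; split=> x; rewrite /prime_hom /=.
  by case: asboolP => // _; case: `[< _ >]; case.
by move=> /asboolP ->; case: `[< _ >]; [right | left].
Qed.

Lemma complete_filterP F :
  inhabited L -> lattice_filter F ->
  complete_filter F <-> forall x, F (x `|` dmneg x).
Proof.
move=> [z] filtF; split=> [[[y Fy] Fc] x|FT].
  by have /(lattice_filterI _ _ filtF)[] := Fc y x Fy.
by split=> [|x y Fx]; [exists (z `|` dmneg z) | exact: filtF.2].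
Qed.

Section Representation.
Variables (n : nat) (h : 'I_n -> L -> dm1) (F : set L).
Hypotheses (n_gt0 : (0 < n)%N) (inhL : inhabited L)
  (hF : @representation DM1 n h F).

Lemma representation_n_prime : n_prime_filter n F.
Proof.
have [homh ->] := hF; apply: bigcap_n_prime_filter; rewrite ?card_ord // => i.
have [hI hU _] := homh i.
exact: prime_filter_preimage hI hU designated_DM1_prime.
Qed.

Lemma representation_completeP :
  complete_filter F <-> forall i x, h i x != DMn.
Proof.
rewrite complete_filterP //; last by case: representation_n_prime.
have [homh ->] := hF.
have hEM i x : designated DM1 (h i (x `|` dmneg x)) <-> h i x != DMn.
  by have [_ hU hN] := homh i; rewrite hU hN DM1_excluded_middleP.
by split=> [FT i x|hn x i _]; apply/hEM; [exact: FT | exact: hn].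
Qed.

Lemma representation_consistent :
  (forall i x, h i x != DMb) -> consistent_filter F.
Proof.
have [homh ->] := hF => hb.
have hcontra i x : ~ designated DM1 (h i (x `&` dmneg x)).
  have [hI _ hN] := homh i; rewrite hI hN => /DM1_contradictionP /eqP.
  exact/negP.
split=> [FT|x y Fxy i _].
  case: inhL => z; have : [set: L] (z `&` dmneg z) by [].
  by rewrite -FT => /(_ (Ordinal n_gt0) I) /hcontra.
have [_ hU _] := homh i; move: (Fxy i I); rewrite /= hU.
by case/(prime_filterU _ _ designated_DM1_prime) => // /hcontra.
Qed.

End Representation.

Lemma n_prime_filter_representation n F :
  (0 < n)%N -> inhabited L -> n_prime_filter n F ->
  exists2 h : 'I_n -> L -> DM1, representation h F
    & consistent_filter F -> forall i x, h i x != DMb.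
Proof.
move=> n_gt0 inhL [filtF idF].
have [u [primeu FE nFu]] := n_prime_filter_residuals filtF n_gt0 inhL idF.
have homu i := prime_hom_morphism (primeu i).
exists (fun i => prime_hom (residual F (u i))).
  by split=> //; under eq_bigcapr do rewrite prime_hom_preimage.
move=> [/nFu nFui Fcons] i x; apply/eqP => hb; apply: (nFui i).
apply: (Fcons x); change (residual F (u i) (x `&` dmneg x)).
rewrite -(prime_hom_preimage (residual F (u i))) /=.
by have [hI _ hN] := homu i; rewrite hI hN; exact/DM1_contradictionP.
Qed.

Lemma n_prime_filterP n F :
  (0 < n)%N -> inhabited L ->
  n_prime_filter n F <-> exists h : 'I_n -> L -> DM1, representation h F.
Proof.
move=> n_gt0 inhL; split=> [|[h]]; last exact: representation_n_prime.
by case/n_prime_filter_representation => // h hF _; exists h.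
Qed.

Lemma consistent_n_prime_filterP n F :
  (0 < n)%N -> inhabited L ->
  n_prime_filter n F /\ consistent_filter F <->
  exists2 h : 'I_n -> L -> DM1, representation h F & forall i x, h i x != DMb.
Proof.
move=> n_gt0 inhL; split=> [[primeF consF]|[h hF hb]].
  have [h hF hb] := n_prime_filter_representation n_gt0 inhL primeF.
  by exists h => //; exact: hb.
split; first exact: representation_n_prime hF.
exact: representation_consistent hF hb.
Qed.

End Homomorphisms.

Lemma mem_P1_universe (v : dm1) : (v \in P1_universe) = (v != DMn).
Proof. by case: v. Qed.

Lemma mem_K1_universe (v : dm1) : (v \in K1_universe) = (v != DMb).
Proof. by case: v. Qed.

Lemma mem_B1_universe (v : dm1) :
  (v \in B1_universe) = (v != DMn) && (v != DMb).
Proof. by case: v. Qed.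

Theorem mainTheorem4 (n : nat) (hn : (1 <= n)%N) (d : Order.disp_t)
    (L : deMorganLatticeType d) (hL : inhabited L) :
  [/\ forall F : set L,
        n_prime_filter n F <-> hom_preimage (power_structure DM1 n) F,
      forall F : set L,
        n_prime_filter n F /\ complete_filter F <->
        hom_preimage (power_structure P1 n) F,
      forall F : set L,
        n_prime_filter n F /\ consistent_filter F <->
        hom_preimage (power_structure K1 n) F
    & forall F : set L,
        n_prime_filter n F /\ classical_filter F <->
        hom_preimage (power_structure B1 n) F].
Proof.
have completeP := representation_completeP hn hL.
split=> F; first by rewrite hom_preimage_powerP n_prime_filterP.
- rewrite hom_preimage_power_substructureP n_prime_filterP //.
  split=> [[[h hF] /(completeP h F hF) hP]|[h hF hP]].
    by exists h => // i x; rewrite mem_P1_universe.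
  split; first by exists h.
  by apply/(completeP h F hF) => i x; rewrite -mem_P1_universe.
- rewrite hom_preimage_power_substructureP consistent_n_prime_filterP //.
  by split=> -[h hF hK]; exists h => // i x;
    have := hK i x; rewrite mem_K1_universe.
rewrite hom_preimage_power_substructureP.
split=> [[primeF [cF kF]]|[h hF hB]].
  have /consistent_n_prime_filterP[//|//|h hF hb] := conj primeF kF.
  by exists h => // i x; rewrite mem_B1_universe hb (completeP h F hF).1.
have {}hB i x : h i x != DMn /\ h i x != DMb.
  by apply/andP; rewrite -mem_B1_universe.
split; first exact: representation_n_prime hF.
split; first by apply/(completeP h F hF) => i x; exact: (hB i x).1.
by apply: (representation_consistent hn hL hF) => i x; exact: (hB i x).2.
Qed.
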